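(* Let $T$ be a closed normal operator on a complex Hilbert space $H$ and let $A$ be a linear operator on $H$ with $\mathcal D(T)\subseteq\mathcal D(A)$ such that, for some constants $a\ge 0$ and $0\le b<1$, $\|Ax\|^2\le a^2\|x\|^2+b^2\|Tx\|^2$ for all $x\in\mathcal D(T)$. Assume that $\sigma(T)\subseteq\{z\in\mathbb C:\gamma_1\le\operatorname{Im} z\le\gamma_2\}$ for some real $\gamma_1<\gamma_2$, and set $\widetilde\gamma=\max\{|\gamma_1|,|\gamma_2|\}$. (i) If $\beta_T\in\mathbb R$ and $\operatorname{Re} t\ge\beta_T$ for all $t\in\sigma(T)$, then every $z\in\sigma(T+A)$ satisfies $$\operatorname{Re} z\ge\beta_T-\sqrt{a^2+b^2\widetilde\gamma^2+b^2\beta_T^2}.$$ (ii) If $\alpha_T\in\mathbb R$ and $\operatorname{Re} t\le\alpha_T$ for all $t\in\sigma(T)$, then every $z\in\sigma(T+A)$ satisfies $$\operatorname{Re} z\le\alpha_T+\sqrt{a^2+b^2\widetilde\gamma^2+b^2\alpha_T^2}.$$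
   Context: $\mathcal D(S)$ denotes the domain of an operator $S$. A closed densely defined operator $T$ on $H$ is normal if $TT^*=T^*T$. The operator $T+A$ has domain $\mathcal D(T)$. The resolvent set $\rho(S)$ is the set of $z\in\mathbb C$ such that $S-z:\mathcal D(S)\to H$ is bijective with bounded inverse; $\sigma(S)=\mathbb C\setminus\rho(S)$. *)

(* Defs.v *)
From HB Require Import structures.
From mathcomp Require Import all_boot all_order all_algebra.
From mathcomp Require Import complex.
From mathcomp Require Import all_classical all_reals topology normedtype.

Set Implicit Arguments.
Unset Strict Implicit.
Unset Printing Implicit Defensive.

Import Order.TTheory GRing.Theory Num.Theory numFieldNormedType.Exports.

Local Open Scope classical_set_scope.
Local Open Scope ring_scope.

(* The values of [app] outside [dom] are irrelevant junk: no notion below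
   depends on them. *)
Record operator (H : Type) := Operator { dom : set H; app :> H -> H }.

Definition op_eq (H : Type) (S T : operator H) : Prop :=
  dom S = dom T /\ {in dom S, S =1 T}.

Definition op_comp (H : Type) (S T : operator H) : operator H :=
  Operator (dom T `&` T @^-1` dom S) (S \o T).

Section Operators.
Variables (R : realType) (H : completeNormedModType R[i]).
Implicit Types S T A : operator H.

Definition linear_operator T : Prop :=
  dom T 0 /\
  forall (c : R[i]) (x y : H), dom T x -> dom T y ->
    dom T (c *: x + y) /\ T (c *: x + y) = c *: T x + T y.

Definition op_graph T : set (H * H) := [set p | dom T p.1 /\ p.2 = T p.1].

Definition closed_operator T : Prop := closed (op_graph T).

(* The sum with domain [dom T] rather than [dom T `&` dom A]; the two agree
   when [dom T `<=` dom A]. *)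
Definition op_add T A : operator H := Operator (dom T) (T \+ A).

Definition op_shift T (z : R[i]) : H -> H := fun x => T x - z *: x.

Definition resolvent_set T : set R[i] :=
  [set z | set_bij (dom T) setT (op_shift T z) /\
    exists2 G : H -> H,
      (forall x, dom T x -> G (op_shift T z x) = x) &
      exists M : R[i], forall y, `|G y| <= M * `|y|].

Definition spectrum T : set R[i] := ~` resolvent_set T.

Variable dot : {dot H for Num.conj}.

Definition adjoint_at T (y w : H) : Prop :=
  forall x, dom T x -> dot (T x) y = dot x w.

(* For densely defined [T] the vector chosen by [xget] is unique. *)
Definition adjoint T : operator H :=
  Operator [set y | exists w, adjoint_at T y w]
           (fun y => xget 0 [set w | adjoint_at T y w]).

Definition normal_operator T : Prop :=
  [/\ linear_operator T, closed_operator T, dense (dom T) &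
      op_eq (op_comp T (adjoint T)) (op_comp (adjoint T) T)].

End Operators.

(* Main.v *)
Require Import Defs.
From mathcomp Require Import all_boot all_order all_algebra.
From mathcomp Require Import complex.
From mathcomp Require Import all_classical all_reals topology normedtype.
From mathcomp Require Import sequences sesquilinear lra ring.

Set Implicit Arguments.
Unset Strict Implicit.
Unset Printing Implicit Defensive.

Import Order.TTheory GRing.Theory Num.Theory.
Import numFieldNormedType.Exports.

Local Open Scope classical_set_scope.
Local Open Scope complex_scope.
Local Open Scope ring_scope.

(** In the language of functional calculus the theorem is short: when [Re z] is
    below the stated bound, [a^2 + b^2 |t|^2 <= q^2 |t - z|^2] on the spectrum
    of [T] with some [q < 1], so that [A (T - z)^-1] has norm at most [q], and a
    Neumann series inverts [T + A - z = (1 + A (T - z)^-1) (T - z)].  The proof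
    below obtains the norm bound without the spectral theorem, from three facts
    about a normal [T], where [T'] stands for its adjoint:
    - [dom T] lies in [dom T'], and [|T' x| = |T x|] there
      ([normal_adjoint_exists], [normal_adjoint_norm]);
    - a closed half-plane that contains the spectrum contains the numerical
      range ([normal_half_plane]);
    - hence, for a spectrum in the strip, [T - T'] is bounded by twice the
      larger of [|gamma1|] and [|gamma2|] ([bounded_skew_part]).
    With [S = (T + T') / 2], the first fact gives both
    [|T x|^2 = |S x|^2 + |(T - T') x|^2 / 4] and
    [|(S - Re z) x| <= |(T - z) x|].  Expanding [S] around the edge [s] of the
    half-plane, the wanted bound compares two quadratic forms in [(S - s) x] and
    [x] whose cross term has a known sign ([normal_relative_bound]).

    The half-plane statement follows from the resolvent estimate
    [dist (z, spectrum T) |x| <= |(T - z) x|] ([normal_shift_lower]) by moving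
    [z] to infinity perpendicularly to the edge.  That estimate says that the
    norm [nu] of [G = (T - z)^-1] is its spectral radius.  For a normal operator
    this is elementary: the norms of the iterates of [N = G / nu] along an orbit
    are log-convex, so an almost norming unit vector [x] has its first [n]
    iterates almost of norm one; by a Parseval argument some
    sum [y] of the [l^j N^j x] over [j < n] with [|l| = 1] satisfies
    [|y|^2 >= n / 4] ([unimodular_trig_sum]), although [y - l N y] telescopes to
    two terms.  So [T] has approximate eigenvalues at distance [1 / nu] from
    [z] ([approx_eigen_step]).  Iterating from there yields a Cauchy sequence of
    ever better approximate eigenvalues, and its limit would be a resolvent
    point if the estimate failed, which is absurd ([resolvent_not_limit]).

    Finally, [dom T] lies in [dom T'] because every [x] in [dom T] is the limit
    of the vectors [(1 + d^2 T' T)^-1 x], which lie in the domain of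
    [T' T = T T'] ([normal_approximation]); they are found by minimising a
    quadratic functional over the graph of [T] ([graph_riesz]). *)

(** * Real-valued norms and real parts of inner products *)
Section RealNorm.
Variable R : realType.

(** The library norm takes its values in [R[i]], whose order is only partial;
    arithmetic on norms is carried out on this real version of it. *)
Definition rnorm (V : normedZmodType R[i]) (x : V) : R := complex.Re `|x|.

Section Zmod.
Variable V : normedZmodType R[i].
Implicit Types x y : V.

Lemma normE x : `|x| = (rnorm x)%:C.
Proof. by rewrite /rnorm RRe_real // normr_real. Qed.

Lemma rnorm_ge0 x : 0 <= rnorm x.
Proof. by rewrite -ler0c -normE. Qed.

Lemma rnormD x y : rnorm (x + y) <= rnorm x + rnorm y.
Proof. by rewrite -lecR rmorphD /= -!normE ler_normD. Qed.

Lemma rnormN x : rnorm (- x) = rnorm x.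
Proof. by rewrite /rnorm normrN. Qed.

Lemma rnorm_distC x y : rnorm (x - y) = rnorm (y - x).
Proof. by rewrite -rnormN opprB. Qed.

Lemma rnorm_eq0 x : (rnorm x == 0) = (x == 0).
Proof. by rewrite -(inj_eq (@complexI R)) -normE normr_eq0. Qed.

Lemma rnorm0 : rnorm (0 : V) = 0.
Proof. by apply/eqP; rewrite rnorm_eq0. Qed.

Lemma rnorm_gt0 x : (0 < rnorm x) = (x != 0).
Proof. by rewrite lt_def rnorm_ge0 andbT rnorm_eq0. Qed.

Lemma rnorm_triangle y x z : rnorm (x - z) <= rnorm (x - y) + rnorm (y - z).
Proof. by have := rnormD (x - y) (y - z); rewrite addrA subrK. Qed.

End Zmod.

Lemma rnormM (c d : R[i]) : rnorm (c * d) = rnorm c * rnorm d.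
Proof. by apply: (@complexI R); rewrite -normE normrM !normE rmorphM. Qed.

Lemma rnormC (r : R) : rnorm (r%:C : R[i]) = `|r|.
Proof. by rewrite /rnorm normc_def /= expr0n addr0 sqrtr_sqr. Qed.

Lemma rnormV (c : R[i]) : rnorm c^-1 = (rnorm c)^-1.
Proof. by apply: (@complexI R); rewrite -normE normfV normE fmorphV. Qed.

Lemma Re_le_rnorm (c : R[i]) : `|complex.Re c| <= rnorm c.
Proof. by rewrite -lecR -normE normc_ge_Re. Qed.

Lemma rnormi : rnorm ('i : R[i]) = 1.
Proof. by rewrite /rnorm normc_def /= expr0n add0r expr1n sqrtr1. Qed.

Variable H : normedModType R[i].
Lemma rnormZ (c : R[i]) (x : H) : rnorm (c *: x) = rnorm c * rnorm x.
Proof. by apply: (@complexI R); rewrite -normE normrZ !normE rmorphM. Qed.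

Lemma rnormZR (r : R) (x : H) : rnorm (r%:C *: x) = `|r| * rnorm x.
Proof. by rewrite rnormZ rnormC. Qed.

End RealNorm.

Section InnerProduct.
Variables (R : realType) (H : normedModType R[i]).
Variable dot : {dot H for Num.conj}.
Hypothesis dot_norm : forall x : H, dot x x = `|x| ^+ 2.
Implicit Types x y : H.

(** A real inner product that determines [dot], whose imaginary part appears
    after multiplying one argument by ['i] ([dot_eqP]). *)
Definition re_dot x y : R := complex.Re (dot x y).
Local Notation ip := re_dot.

Lemma dotC x y : dot x y = (dot y x)^*%C.
Proof. by rewrite hermC mul1r. Qed.

Lemma ipC x y : ip x y = ip y x.
Proof. by rewrite /re_dot dotC; case: (dot y x). Qed.

Lemma dotZl c x y : dot (c *: x) y = c * dot x y.
Proof. by rewrite linearZl_LR. Qed.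

Lemma dotZr c x y : dot x (c *: y) = c^*%C * dot x y.
Proof. by rewrite linearZr_LR. Qed.

Lemma dotDl x1 x2 y : dot (x1 + x2) y = dot x1 y + dot x2 y.
Proof. by rewrite linearDl. Qed.

Lemma ipDl x1 x2 y : ip (x1 + x2) y = ip x1 y + ip x2 y.
Proof. by rewrite /re_dot dotDl; case: (dot x1 y); case: (dot x2 y). Qed.

Lemma ipDr x y1 y2 : ip x (y1 + y2) = ip x y1 + ip x y2.
Proof. by rewrite ipC ipDl !(ipC x). Qed.

Lemma ipZl (r : R) x y : ip (r%:C *: x) y = r * ip x y.
Proof. by rewrite /re_dot dotZl; case: (dot x y) => p q /=; ring. Qed.

Lemma ipZr (r : R) x y : ip x (r%:C *: y) = r * ip x y.
Proof. by rewrite ipC ipZl ipC. Qed.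

Lemma ipNl x y : ip (- x) y = - ip x y.
Proof. by rewrite -scaleN1r -(rmorphN1 (real_complex R)) ipZl mulN1r. Qed.

Lemma ipNr x y : ip x (- y) = - ip x y.
Proof. by rewrite ipC ipNl ipC. Qed.

Lemma ip0l y : ip 0 y = 0.
Proof. by rewrite -(scale0r 0) (ipZl 0) mul0r. Qed.

Lemma ip0r x : ip x 0 = 0.
Proof. by rewrite ipC ip0l. Qed.

Definition ipE := (ipDl, ipDr, ipNl, ipNr, ipZl, ipZr, ip0l, ip0r).

Lemma ipxx x : ip x x = rnorm x ^+ 2.
Proof. by rewrite /re_dot dot_norm normE -rmorphXn. Qed.

Lemma Im_dot x y : complex.Im (dot x y) = ip x ('i *: y).
Proof. by rewrite /re_dot dotZr; case: (dot x y) => p q /=; ring. Qed.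

Lemma ipii x y : ip ('i *: x) ('i *: y) = ip x y.
Proof. by rewrite /re_dot dotZr dotZl; case: (dot x y) => p q /=; ring. Qed.

Lemma ip_il x y : ip ('i *: x) y = - ip x ('i *: y).
Proof. by rewrite -[in LHS]ipii scalerA -[_ * _]/('i ^+ 2) sqr_i scaleN1r
  ipNl. Qed.

Lemma dot_eqP x1 y1 x2 y2 :
  ip x1 y1 = ip x2 y2 -> ip x1 ('i *: y1) = ip x2 ('i *: y2) ->
  dot x1 y1 = dot x2 y2.
Proof.
rewrite -!Im_dot /re_dot; case: (dot x1 y1) => a b; case: (dot x2 y2) => c d /=.
by move=> -> ->.
Qed.

Lemma rnormD_sqr x y : rnorm (x + y) ^+ 2 = rnorm x ^+ 2 + 2 * ip x y + rnorm
  y ^+ 2.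
Proof. by rewrite -!ipxx !ipE (ipC y x); ring. Qed.

Lemma rnormB_sqr x y : rnorm (x - y) ^+ 2 = rnorm x ^+ 2 - 2 * ip x y + rnorm
  y ^+ 2.
Proof. by rewrite rnormD_sqr rnormN ipNr; ring. Qed.

Lemma parallelogram (x y : H) :
  rnorm (x + y) ^+ 2 + rnorm (x - y) ^+ 2 = 2 * (rnorm x ^+ 2 + rnorm y ^+ 2).
Proof. by rewrite rnormB_sqr rnormD_sqr; ring. Qed.

Lemma ip_le x y : ip x y <= rnorm x * rnorm y.
Proof.
have [->|x0] := eqVneq x 0; first by rewrite ip0l rnorm0 mul0r.
have [->|y0] := eqVneq y 0; first by rewrite ip0r rnorm0 mulr0.
move: x0 y0; rewrite -!rnorm_gt0 => x0 y0.
have := sqr_ge0 (rnorm ((rnorm y)%:C *: x - (rnorm x)%:C *: y)).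
rewrite rnormB_sqr !ipE !rnormZR !gtr0_norm // => h.
rewrite -(ler_pM2l (mulr_gt0 x0 y0)); lra.
Qed.

Lemma ip_abs x y : `|ip x y| <= rnorm x * rnorm y.
Proof.
by rewrite ler_norml ip_le andbT lerNl -ipNl (le_trans (ip_le _ _)) // rnormN.
Qed.

(** The real inequality applies to [y] multiplied by the scalar [dot x y],
    which makes the inner product real and nonnegative. *)
Lemma rnorm_dot (x y : H) : rnorm (dot x y) <= rnorm x * rnorm y.
Proof.
have [->|d0] := eqVneq (dot x y) 0; first by rewrite rnorm0 mulr_ge0 ?rnorm_ge0.
move: d0; rewrite -rnorm_gt0 => d0; rewrite -(ler_pM2l d0).
have := ip_le x (dot x y *: y); rewrite rnormZ mulrCA; apply: le_trans.
rewrite /re_dot dotZr le_eqVlt; apply/orP; left; apply/eqP.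
by rewrite [X in complex.Re X]mulrC -sqr_normc normE -rmorphXn -expr2.
Qed.

End InnerProduct.

(** * Geometric limits and the Riesz theorem on a graph *)
Section GeometricLimits.
Variable R : realType.

Lemma geometric_lt (C q e : R) : 0 <= q < 1 -> 0 < e ->
  exists N, forall n, (N <= n)%N -> C * q ^+ n < e.
Proof.
move=> /andP[q0 q1] e0.
have /cvgr0Pnorm_lt/(_ _ e0)[N _ hN] : geometric C q @ \oo --> (0 : R^o).
  by apply: cvg_geometric; rewrite ger0_norm.
exists N => n /hN /=; apply: le_lt_trans; exact: ler_norm.
Qed.

(** Lets every passage to the limit below be a comparison at finite [n]. *)
Lemma le0_geometric (C q a : R) : 0 <= q < 1 ->
  (forall n, a <= C * q ^+ n) -> a <= 0.
Proof.
move=> q1 ha; rewrite leNgt; apply/negP => a0.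
by have [N /(_ N (leqnn N))] := geometric_lt C q1 a0; rewrite ltNge ha.
Qed.

Lemma half_itv : 0 <= (2^-1 : R) < 1.
Proof. by lra. Qed.

Variable H : completeNormedModType R[i].

Lemma rnorm_cvg (u : nat -> H) (l : H) (C q : R) : 0 <= q < 1 ->
  (forall n, rnorm (u n - l) <= C * q ^+ n) -> u @ \oo --> l.
Proof.
move=> q1 hu; apply/cvgrPdist_lt => e e0.
have eE : e = (complex.Re e)%:C by rewrite RRe_real // gtr0_real.
have [N hN] : exists N, forall n, (N <= n)%N -> C * q ^+ n < complex.Re e.
  by apply: geometric_lt => //; rewrite -ltcR -eE.
exists N => // n /hN h /=.
by rewrite normE eE ltcR rnorm_distC (le_lt_trans (hu n)).
Qed.

Lemma geometric_limit (u : nat -> H) (C q : R) : 0 <= q < 1 ->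
  (forall n, rnorm (u n.+1 - u n) <= C * q ^+ n) ->
  exists l, forall n, rnorm (u n - l) <= C / (1 - q) * q ^+ n.
Proof.
move=> q01 hu; have /andP[q0 q1] := q01.
have C0 : 0 <= C by have := hu 0%N; rewrite expr0 mulr1; apply: le_trans;
  exact: rnorm_ge0.
have q1' : 0 < 1 - q by rewrite subr_gt0.
set K := C / (1 - q).
have K0 : 0 <= K by rewrite divr_ge0 // ltW.
have KE : C = K * (1 - q) by rewrite /K divfK // gt_eqF.
have step n k : rnorm (u (n + k)%N - u n) <= K * q ^+ n.
  have : rnorm (u (n + k)%N - u n) <= K * q ^+ n * (1 - q ^+ k).
    elim: k => [|k IH]; first by rewrite addn0 subrr rnorm0 expr0 subrr mulr0.
    apply: le_trans (rnorm_triangle (u (n + k)%N) _ _) _.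
    rewrite addnS; apply: le_trans (lerD (hu _) IH) _.
    by rewrite KE exprD exprS; lra.
  move/le_trans; apply; rewrite ler_piMr ?(mulr_ge0 K0) ?exprn_ge0 //.
  by rewrite lerBlDr lerDl exprn_ge0.
have cu : cauchy (u @ \oo).
  apply: cauchy_exP => e e0.
  have eE : e = (complex.Re e)%:C by rewrite RRe_real // gtr0_real.
  have [N /(_ N (leqnn N)) hN] : exists N, forall n,
    (N <= n)%N -> K * q ^+ n < complex.Re e.
    by apply: geometric_lt => //; rewrite -ltcR -eE.
  exists (u N); exists N => // n /= /subnKC <-.
  by rewrite -ball_normE /= normE eE ltcR rnorm_distC (le_lt_trans (step _ _)).
have cvu : cvg (u @ \oo) by exact: cauchy_cvg cu.
exists (lim (u @ \oo)) => n.
rewrite leNgt; apply/negP => hlt.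
set l := lim _ in hlt.
pose e := rnorm (u n - l) - K * q ^+ n.
have e0 : 0 < e by rewrite subr_gt0.
have : (0 : R[i]) < e%:C by rewrite ltcR.
move/(iffLR (cvgrPdist_lt _ _) cvu) => [N _ /(_ (n + N)%N)].
rewrite /= leq_addl normE ltcR -/l => /(_ isT) h.
have := rnorm_triangle (u (n + N)%N) (u n) l.
have := step n N; rewrite (rnorm_distC _ (u n)); move: h;
  rewrite (rnorm_distC l) /e; lra.
Qed.

End GeometricLimits.

Section GraphRiesz.
Variables (R : realType) (H : completeNormedModType R[i]).
Variable dot : {dot H for Num.conj}.
Hypothesis dot_norm : forall x : H, dot x x = `|x| ^+ 2.
Local Notation ip := (re_dot dot).
Let h : R := 2^-1.

Variables (D : set H) (B : H -> H) (f : H -> R) (M : R).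
Hypothesis D0 : D 0.
Hypothesis linDBf : forall r x y, D x -> D y ->
  [/\ D (r%:C *: x + y), B (r%:C *: x + y) = r%:C *: B x + B y
    & f (r%:C *: x + y) = r * f x + f y].
Hypothesis M0 : 0 <= M.
Hypothesis f_bounded : forall x, D x ->
  f x ^+ 2 <= M * (rnorm x ^+ 2 + rnorm (B x) ^+ 2).

Let g x y := ip x y + ip (B x) (B y).
Let J x := g x x - 2 * f x.

Let J_expand s x y : D x -> D y ->
  J (s%:C *: y + x) = J x + 2 * s * (g x y - f y) + s ^+ 2 * g y y.
Proof.
move=> Dx Dy; have [_ EB Ef] := linDBf s Dy Dx.
by rewrite /J /g EB Ef !ipE (ipC dot y x) (ipC dot (B y)); ring.
Qed.

Let J_lower x : D x -> - M <= J x.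
Proof.
move=> /f_bounded; rewrite -!(ipxx dot_norm) -/(g x x) => hf.
have g0 : 0 <= g x x by rewrite /g !(ipxx dot_norm) addr_ge0 // sqr_ge0.
have : (2 * f x) ^+ 2 <= (g x x + M) ^+ 2 by have := sqr_ge0 (g x x - M); lra.
rewrite /J => hs; rewrite leNgt; apply/negP => hlt.
have p1 : 0 < 2 * f x - (g x x + M) by lra.
have p2 : 0 < 2 * f x + (g x x + M) by have := M0; lra.
by have := mulr_gt0 p1 p2; lra.
Qed.

(** The minimiser of [|x|^2 + |B x|^2 - 2 f x] over [D] represents [f] for the
    graph inner product. By the parallelogram law a minimising sequence is
    Cauchy for the graph norm; since the graph of [B] need not be closed, only
    the limits [w] and [w'] of the two components are asserted to exist. *)
Lemma graph_riesz : exists w w' (u : nat -> H) (C : R),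
  (forall n, [/\ D (u n), rnorm (u n - w) <= C * h ^+ n
               & rnorm (B (u n) - w') <= C * h ^+ n]) /\
  forall y, D y -> f y = ip y w + ip (B y) w'.
Proof.
pose E := [set J x | x in D].
have hE : has_inf E.
  by split; [exists (J 0), 0|exists (- M) => _ [x /J_lower ? <-]].
pose d n := h ^+ n.
have d0 n : 0 < d n by rewrite exprn_gt0 // /h; lra.
have dS n : d n.+1 = h * d n by rewrite /d exprS.
have minJ x : D x -> inf E <= J x.
  by move=> Dx; apply: ge_inf; [case: hE|exists x].
have /choice[u /all_and2[Du Ju]] n : exists x, D x /\ J x <= inf E + d n ^+ 2.
  have [_ [x Dx <-] /ltW ?] := inf_adherent (exprn_gt0 2 (d0 n)) hE.
  by exists x.
have gE x : g x x = rnorm x ^+ 2 + rnorm (B x) ^+ 2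
  by rewrite /g !(ipxx dot_norm).
(* The midpoint of [u n] and [u n.+1] has energy at least [inf E]. *)
have step n : g (u n.+1 - u n) (u n.+1 - u n) <= (2 * d n) ^+ 2
    /\ B (u n.+1 - u n) = B (u n.+1) - B (u n).
  have [] := linDBf (-1) (Du n) (Du n.+1).
  rewrite rmorphN1 !scaleN1r ![- _ + _]addrC; set v := u n.+1 - u n => Dv EB _.
  split=> //; have Ev : (1 : R)%:C *: v + u n = u n.+1.
    by rewrite scale1r subrK.
  have [Dm _ _] := linDBf h Dv (Du n).
  have := J_expand 1 (Du n) Dv; rewrite Ev => E1.
  have E2 := J_expand h (Du n) Dv.
  have := minJ _ Dm; have := Ju n; have := Ju n.+1.
  rewrite E2 E1 dS /h; have := d0 n; nra.
have stepu n : rnorm (u n.+1 - u n) <= 2 * d n.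
  have [+ _] := step n; rewrite gE => hs; have := d0 n.
  by rewrite leNgt => ?; apply/negP => ?; nra.
have stepB n : rnorm (B (u n.+1) - B (u n)) <= 2 * d n.
  have [+ <-] := step n; rewrite gE => hs; have := d0 n.
  by rewrite leNgt => ?; apply/negP => ?; nra.
have [w hw] := geometric_limit (half_itv R) stepu.
have [w' hw'] := geometric_limit (half_itv R) stepB.
exists w, w', u, (2 / (1 - h)); split=> [n|y Dy]; first by split.
(* The gradient at an almost minimiser: move by [d n] in the directions [y]
   and [- y]. *)
have near n : `|f y - g (u n) y| <= (1 + g y y) * d n.
  have [Dp _ _] := linDBf (d n) Dy (Du n).
  have [Dm _ _] := linDBf (- d n) Dy (Du n).
  have := minJ _ Dp; have := minJ _ Dm; have := Ju n.
  rewrite !J_expand // => h1 h2 h3.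
  have g0 : 0 <= g y y by rewrite gE addr_ge0 // sqr_ge0.
  rewrite ler_norml; apply/andP; split; rewrite -(ler_pM2l (d0 n)); nra.
pose C := 2 / (1 - h).
apply/eqP; rewrite -subr_eq0 -normr_le0.
apply: (le0_geometric (C := 1 + g y y + C * (rnorm y + rnorm (B y)))
  (half_itv R)) => n.
have -> : f y - (ip y w + ip (B y) w') =
    f y - g (u n) y + (ip y (u n - w) + ip (B y) (B (u n) - w')).
  by rewrite /g !ipE (ipC dot (u n)) (ipC dot (B (u n))); ring.
have i1 := le_trans (ip_abs dot_norm y (u n - w)) (ler_wpM2l (rnorm_ge0 y)
  (hw n)).
have i2 := le_trans (ip_abs dot_norm (B y) (B (u n) - w')) (ler_wpM2l
  (rnorm_ge0 (B y)) (hw' n)).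
apply: le_trans (ler_normD _ _) _.
apply: le_trans (lerD (near n) (ler_normD _ _)) _.
by apply: le_trans (lerD (lexx _) (lerD i1 i2)) _; rewrite /d /C; lra.
Qed.
End GraphRiesz.

(** * Linear operators and adjoints *)
Section LinearOperators.
Variables (R : realType) (H : completeNormedModType R[i]) (T : operator H).
Hypothesis linT : linear_operator T.
Implicit Types x y : H.

Lemma op_dom0 : dom T 0. Proof. exact: linT.1. Qed.

Lemma op_domZD c x y : dom T x -> dom T y -> dom T (c *: x + y).
Proof. by move=> Dx Dy; have [] := linT.2 c x y Dx Dy. Qed.

Lemma opZD c x y : dom T x -> dom T y -> T (c *: x + y) = c *: T x + T y.
Proof. by move=> Dx Dy; have [] := linT.2 c x y Dx Dy. Qed.

Lemma op_domD x y : dom T x -> dom T y -> dom T (x + y).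
Proof. by rewrite -[in dom T (_ + _)](scale1r x); exact: op_domZD. Qed.

Lemma opD x y : dom T x -> dom T y -> T (x + y) = T x + T y.
Proof. by move=> Dx Dy; rewrite -[in LHS](scale1r x) opZD // scale1r. Qed.

Lemma op0 : T 0 = 0.
Proof.
have := opD op_dom0 op_dom0.
by rewrite addr0 => /(congr1 (+%R^~ (- T 0))); rewrite subrr addrK.
Qed.

Lemma op_domZ c x : dom T x -> dom T (c *: x).
Proof. by move=> Dx; rewrite -[_ *: _]addr0; apply: op_domZD => //;
  exact: op_dom0. Qed.

Lemma opZ c x : dom T x -> T (c *: x) = c *: T x.
Proof. by move=> Dx; rewrite -[_ *: _ in LHS]addr0 opZD ?op0 ?addr0 //;
  exact: op_dom0. Qed.

Lemma op_domB x y : dom T x -> dom T y -> dom T (x - y).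
Proof. by move=> Dx Dy; rewrite -scaleN1r; apply: op_domD => //;
  exact: op_domZ. Qed.

Lemma opB x y : dom T x -> dom T y -> T (x - y) = T x - T y.
Proof.
move=> Dx Dy; rewrite -[- y]scaleN1r opD ?opZ ?scaleN1r //.
by rewrite -scaleN1r; exact: op_domZ.
Qed.

Lemma closed_operator_limit (u : nat -> H) (w v : H) (C q : R) :
  closed_operator T -> 0 <= q < 1 ->
  (forall n, [/\ dom T (u n), rnorm (u n - w) <= C * q ^+ n
               & rnorm (T (u n) - v) <= C * q ^+ n]) ->
  dom T w /\ v = T w.
Proof.
move=> clT q1 /all_and3[Du hw hv].
have cw := rnorm_cvg q1 hw; have cv := rnorm_cvg q1 hv.
have cp : (fun n => (u n, T (u n))) @ \oo --> (w, v) by exact: cvg_pair.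
apply: (closed_cvg (op_graph T) clT _ (w, v) cp).
by near=> n; split=> //=.
Unshelve. all: by end_near. Qed.

End LinearOperators.

Section Adjoint.
Variables (R : realType) (H : completeNormedModType R[i]).
Variable dot : {dot H for Num.conj}.
Hypothesis dot_norm : forall x : H, dot x x = `|x| ^+ 2.
Local Notation ip := (re_dot dot).

(** Test against vectors [y] of [D] that are close to [v] itself. *)
Lemma dense_ip_bound (D : set H) (v : H) (C : R) : dense D -> 0 <= C ->
  (forall y, D y -> `|ip y v| <= C * rnorm y) -> rnorm v <= C.
Proof.
move=> dD C0 hv; rewrite leNgt; apply/negP => hC.
have e0 : (0 : R[i]) < ((rnorm v - C) / 4)%:C by rewrite ltcR; lra.
have [||y []] := dD (ball v ((rnorm v - C) / 4)%:C).
- by exists v; exact: ballxx.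
- exact: ball_open.
rewrite -ball_normE /= normE ltcR => hy Dy.
have h1 := le_trans (ler_norm _) (hv y Dy).
have h2 := ip_le dot_norm (v - y) v.
have h3 := rnormD (y - v) v; rewrite subrK rnorm_distC in h3.
have h4 : rnorm v ^+ 2 = ip y v + ip (v - y) v.
  by rewrite -(ipxx dot_norm) !ipE; ring.
have n0 : 0 < rnorm v by lra.
nra.
Qed.

Variable T : operator H.
Hypothesis linT : linear_operator T.

(** Replacing [y] by ['i *: y] recovers the imaginary part of [dot]. *)
Lemma adjoint_at_ip z w :
  (forall y, dom T y -> ip (T y) z = ip y w) -> adjoint_at dot T z w.
Proof.
move=> h y Dy; apply: dot_eqP; first exact: h.
by apply: oppr_inj; rewrite -!ip_il -h ?opZ //; exact: op_domZ.
Qed.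

Lemma adjoint_atE y z w : adjoint_at dot T z w -> dom T y -> ip
  (T y) z = ip y w.
Proof. by move=> h Dy; rewrite /re_dot h. Qed.

(** The Riesz theorem for the functional [ip (T _) z], which is bounded on the
    dense domain of [T]: here the graph is that of the zero map. *)
Lemma adjoint_at_exists z C : dense (dom T) -> 0 <= C ->
  (forall y, dom T y -> `|ip (T y) z| <= C * rnorm y) ->
  exists w, adjoint_at dot T z w.
Proof.
move=> dD C0 hz.
have [|r x y Dx Dy|||w [w' [u [K [_ hw]]]]] :=
  @graph_riesz R H dot dot_norm (dom T) (fun _ => 0) (fun y =>
    ip (T y) z) (C ^+ 2).
- exact: op_dom0.
- by split; rewrite ?scaler0 ?addr0 ?opZD ?ipE //; exact: op_domZD.
- exact: sqr_ge0.
- move=> x Dx; rewrite rnorm0 expr0n addr0 -exprMn -real_normK ?num_real //.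
  by rewrite lerXn2r ?nnegrE ?mulr_ge0 ?rnorm_ge0 ?hz.
by exists w; apply: adjoint_at_ip => y Dy; rewrite hw // ip0l addr0.
Qed.

End Adjoint.

(** * Resolvents and approximate eigenvalues *)
Section Resolvent.
Variables (R : realType) (H : completeNormedModType R[i]) (T : operator H).
Hypothesis linT : linear_operator T.

Lemma op_shiftZD z c x y : dom T x -> dom T y ->
  op_shift T z (c *: x + y) = c *: op_shift T z x + op_shift T z y.
Proof.
move=> Dx Dy; rewrite /op_shift opZD // scalerDr scalerBr opprD addrACA.
by rewrite !scalerA (mulrC z).
Qed.

(** The bound in [resolvent_set] is a complex number, possibly junk when [H] is
    trivial; its real part, cut off at [0], is always a usable bound. *)
Lemma resolventP z : resolvent_set T z -> exists (G : H -> H) (M : R),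
  [/\ 0 <= M, forall y, dom T (G y), forall y, op_shift T z (G y) = y,
      forall x, dom T x -> G (op_shift T z x) = x &
      forall y, rnorm (G y) <= M * rnorm y].
Proof.
case=> -[_ _ surj] [G GK [M hM]]; exists G, (Num.max 0 (complex.Re M)).
have GE y : dom T (G y) /\ op_shift T z (G y) = y.
  by have [x Dx <-] := surj y I; rewrite GK.
split=> //; [by rewrite le_max lexx|by move=> y; case: (GE y)..|].
move=> y; have := hM y; rewrite !normE lecE => /andP[_ h].
apply: le_trans h _.
have -> : complex.Re (M * (rnorm y)%:C) = complex.Re M * rnorm y.
  by case: M {hM} => p q /=; ring.
by rewrite ler_wpM2r ?rnorm_ge0 // le_max lexx orbT.
Qed.

Lemma resolvent_linear z (G : H -> H) :
  (forall y, dom T (G y)) -> (forall y, op_shift T z (G y) = y) ->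
  (forall x, dom T x -> G (op_shift T z x) = x) ->
  forall c x y, G (c *: x + y) = c *: G x + G y.
Proof.
move=> DG GK KG c x y; rewrite -{1}(GK x) -{1}(GK y) -op_shiftZD //.
by rewrite KG //; exact: op_domZD.
Qed.

Lemma op_shift_shift w z x : op_shift T w x = op_shift T z x - (w - z) *: x.
Proof. by rewrite /op_shift scalerBl opprB addrA subrK. Qed.

Definition approx_eigen w c :=
  exists u, [/\ dom T u, 0 < rnorm u & rnorm (op_shift T w u) <= c * rnorm u].

(** A resolvent point [w] has [|x| <= M |(T - w) x|], which fails when
    approximate eigenvalues of vanishing defect accumulate at [w]. *)
Lemma resolvent_not_limit (w : R[i]) (W : nat -> R[i]) (C q : R) :
  resolvent_set T w -> 0 <= q < 1 ->
  (forall n, rnorm (W n - w) <= C * q ^+ n) ->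
  (forall n, approx_eigen (W n) (C * q ^+ n)) -> False.
Proof.
move=> rw q1 hW aW.
have [G [M [M0 _ _ KG hM]]] := resolventP rw.
have : (1 : R) <= 0.
  apply: (le0_geometric (C := M * (C + C)) q1) => n.
  have [u [Du u0 hu]] := aW n.
  have h1 := hM (op_shift T w u); rewrite KG // in h1.
  have h2 : rnorm (op_shift T w u) <= (C * q ^+ n + C * q ^+ n) * rnorm u.
    rewrite (op_shift_shift _ (W n)) -scaleNr opprB mulrDl.
    apply: le_trans (rnormD _ _) (lerD hu _).
    by rewrite rnormZ ler_wpM2r // ltW.
  rewrite -(ler_pM2r u0) mul1r; apply: le_trans h1 _.
  apply: le_trans (ler_wpM2l M0 h2) _.
  by lra.
by rewrite ler10.
Qed.

End Resolvent.

(** * Operators of norm one with log-convex orbits *)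
Section ApproximateEigenvalue.
Variables (R : realType) (H : normedModType R[i]).
Variable dot : {dot H for Num.conj}.
Hypothesis dot_norm : forall x : H, dot x x = `|x| ^+ 2.

Lemma unimodular_sqrt (c : R[i]) : rnorm c = 1 ->
  exists2 s : R[i], rnorm s = 1 & s ^+ 2 = c.
Proof.
move=> c1; exists (sqrtc c); last exact: sqr_sqrtc.
apply/eqP; rewrite -(eqrXn2 (n := 2)) ?rnorm_ge0 // expr1n.
by rewrite expr2 -rnormM -expr2 sqr_sqrtc c1.
Qed.

(** On average over the [2^k] roots [l] of [c], the right-hand side equals the
    left-hand side; an explicit [l] is found by bisection. Fixing [l^(2^(k-1))
    = t] folds the second half of the sequence onto the first with weight [t],
    and by the parallelogram law one of the two square roots [t] of [c] does
    not decrease the sum of squares. *)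
Lemma unimodular_trig_sum k (c : R[i]) (a : nat -> H) : rnorm c = 1 ->
  exists l : R[i], [/\ rnorm l = 1, l ^+ (2 ^ k) = c &
    \sum_(j < 2 ^ k) rnorm (a j) ^+ 2 <= rnorm
      (\sum_(j < 2 ^ k) l ^+ j *: a j) ^+ 2].
Proof.
elim: k c a => [|k IH] c a c1.
  by exists c; split=> //; rewrite expn0 !big_ord1 expr0 scale1r.
have [s s1 sE] := unimodular_sqrt c1.
set m := (2 ^ k)%N in IH *.
have mE : (2 ^ k.+1 = m + m)%N by rewrite expnS mul2n addnn.
pose S t := \sum_(j < m) rnorm (a j + t *: a (m + j)%N) ^+ 2.
have sumS : S s + S (- s) = 2 * \sum_(j < m + m) rnorm (a j) ^+ 2.
  rewrite big_split_ord /= -!big_split /= mulr_sumr; apply: eq_bigr => j _.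
  by rewrite scaleNr (parallelogram dot_norm) rnormZ s1 mul1r.
have [t [t1 tE tS]] : exists t : R[i], [/\ rnorm t = 1, t ^+ 2 = c &
    \sum_(j < m + m) rnorm (a j) ^+ 2 <= S t].
  have [h|h] := leP (\sum_(j < m + m) rnorm (a j) ^+ 2) (S s);
    first by exists s.
  by exists (- s); rewrite rnormN sqrrN; split=> //; lra.
have [l [l1 lE lS]] := IH t (fun j => a j + t *: a (m + j)%N) t1.
exists l; rewrite mE; split=> //; first by rewrite exprD lE -expr2.
apply: le_trans tS (le_trans lS _).
rewrite big_split_ord /= -big_split /= le_eqVlt; apply/orP; left; apply/eqP.
congr (rnorm _ ^+ 2); apply: eq_bigr => j _.
by rewrite scalerDr scalerA exprD lE mulrC.
Qed.

Variable N : H -> H.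
Hypothesis linN : forall (c : R[i]) x y, N (c *: x + y) = c *: N x + N y.
Hypothesis contrN : forall x, rnorm (N x) <= rnorm x.
Hypothesis convN : forall x, rnorm (N x) ^+ 2 <= rnorm (N (N x)) * rnorm x.
Hypothesis normN : forall e : R, 0 < e ->
  exists x, rnorm x = 1 /\ 1 - e <= rnorm (N x).

(** Log-convexity makes the ratios of successive norms along the orbit
    nondecreasing, so all of them are at least [1 - e]; the conclusion is then
    Bernoulli's inequality. *)
Lemma log_convex_orbit_lower x (e : R) j : e <= 1 ->
  rnorm x = 1 -> 1 - e <= rnorm (N x) -> 1 - j%:R * e <= rnorm (iter j N x).
Proof.
move=> e1 x1 Nx.
have ratio i : (1 - e) * rnorm (iter i N x) <= rnorm (iter i.+1 N x).
  elim: i => [|i IH]; first by rewrite /= x1 mulr1.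
  have := convN (iter i N x); move: IH => /=.
  set p := rnorm (iter i N x); set q := rnorm (N (iter i N x)).
  set r := rnorm (N (N (iter i N x))) => pq qrp.
  have r0 : 0 <= r by exact: rnorm_ge0.
  have [q0|q0] := eqVneq q 0; first by rewrite q0 mulr0.
  have {q0} q0 : 0 < q by rewrite lt_def q0 rnorm_ge0.
  rewrite -(ler_pM2r q0); nra.
elim: j => [|j IH]; first by rewrite mul0r subr0 /= x1.
apply: le_trans (ratio j); rewrite -natr1.
have := ler0n R j; nra.
Qed.

(** The operator has norm one; it need not have an eigenvalue of modulus one,
    but [y], a trigonometric sum over [n] iterates of an almost norming [x],
    has norm of order [sqrt n] while [y - l *: N y] is the difference of two
    vectors of norm at most one. *)
Lemma approximate_eigenvalue (eta : R) : 0 < eta ->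
  exists (l : R[i]) (y : H),
    [/\ rnorm l = 1, 0 < rnorm y & rnorm (y - l *: N y) <= eta * rnorm y].
Proof.
move=> eta0.
have [k hk] : exists k, 16 / eta ^+ 2 <= (2 ^ k)%:R.
  exists (Num.bound (16 / eta ^+ 2)).
  apply: le_trans (ltW (archi_boundP _)) _;
    first by rewrite divr_ge0 // sqr_ge0.
  by rewrite ler_nat ltnW // ltn_expl.
set n := (2 ^ k)%N in hk.
have n0 : 0 < n%:R :> R by rewrite ltr0n expn_gt0.
have n1 : 1 <= n%:R :> R by rewrite ler1n expn_gt0.
(* With this [e] the first [n] iterates of [x] keep norm at least [1 / 2]. *)
pose e : R := (2 * n%:R)^-1.
have e0 : 0 < e by rewrite invr_gt0 mulr_gt0.
have ne : n%:R * e = 2^-1 by rewrite /e; field; rewrite gt_eqF.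
have e1 : e <= 1 by nra.
have [x [x1 Nx]] := normN e0.
pose a j := iter j N x.
have alow (j : 'I_n) : 2^-1 <= rnorm (a j).
  apply: le_trans (log_convex_orbit_lower j e1 x1 Nx).
  have : (j%:R : R) <= n%:R by rewrite ler_nat ltnW.
  nra.
have aup j : rnorm (a j) <= 1.
  by elim: j => [|j IH]; [rewrite /= x1|apply: le_trans (contrN _) IH].
have [l [l1 _ lS]] := unimodular_trig_sum k a (rnormi R).
rewrite -/n in lS; set y := \sum_(j < n) _ *: _ in lS.
have N0 : N 0 = 0.
  have := linN 1 0 0; rewrite !scale1r addr0 => /(congr1 (+%R^~ (- N 0))).
  by rewrite subrr addrK.
have tele i : \sum_(j < i) l ^+ j *: a j - l *: N
  (\sum_(j < i) l ^+ j *: a j) = x - l ^+ i *: a i.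
  elim: i => [|i IH]; first by rewrite !big_ord0 N0 scaler0 expr0 scale1r
    !subrr.
  rewrite big_ord_recr /=; set S := \sum_(j < i) _ in IH *.
  rewrite [S + _]addrC linN scalerDr scalerA -exprS opprD addrACA IH.
  by rewrite addrC addrA subrK.
have hy : rnorm (y - l *: N y) <= 2.
  rewrite tele; apply: le_trans (rnormD _ _) _; rewrite rnormN rnormZ x1.
  have -> : rnorm (l ^+ n) = 1.
    by elim: (n) => [|i IH]; rewrite ?expr0 ?exprS ?rnormM ?l1 ?IH ?mulr1 //
      rnormC normr1.
  have := aup n; lra.
have ylow : n%:R / 4 <= rnorm y ^+ 2.
  apply: le_trans lS.
  have -> : n%:R / 4 = \sum_(j < n) (4^-1 : R)
    by rewrite sumr_const card_ord mulr_natl.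
  by apply: ler_sum => j _; have := alow j; nra.
have eta2 : 16 <= eta ^+ 2 * n%:R.
  by move: hk; rewrite ler_pdivrMr ?exprn_gt0 // mulrC.
exists l, y; split=> //.
  by rewrite lt_def rnorm_ge0 andbT; apply/eqP => y0; move: ylow; rewrite y0;
    nra.
apply: le_trans hy _; rewrite leNgt; apply/negP => hlt.
have h0 : 0 <= eta * rnorm y by rewrite mulr_ge0 ?rnorm_ge0 // ltW.
have := ler_wpM2l (sqr_ge0 eta) ylow; nra.
Qed.
End ApproximateEigenvalue.

(** * The adjoint of a normal operator *)
Section NormalOperators.
Variables (R : realType) (H : completeNormedModType R[i]).
Variable dot : {dot H for Num.conj}.
Hypothesis dot_norm : forall x : H, dot x x = `|x| ^+ 2.
Local Notation ip := (re_dot dot).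
Variable T : operator H.
Hypothesis normT : normal_operator dot T.

Let linT : linear_operator T. Proof. by case: normT. Qed.
Let clT : closed_operator T. Proof. by case: normT. Qed.
Let denseT : dense (dom T). Proof. by case: normT. Qed.
Let commT : op_eq (op_comp T (adjoint dot T)) (op_comp (adjoint dot T) T).
Proof. by case: normT. Qed.

(** The vector [x'] solves [x' + d^2 T' (T x') = x], where [T'] is the adjoint,
    and [v] is [T' x']. It lies in the domain of [T' T], hence of [T T'], which
    identifies [|T x'|] with [|T' x'|]. Testing the equation against [x' - x]
    shows that [T x'] is no longer than [T x] and that [x'] tends to [x]. *)
Lemma normal_approximation x (d : R) : dom T x -> 0 < d -> exists x' v,
  [/\ dom T x', dom T v, adjoint_at dot T x' v & adjoint_at dot T (T x')
    (T v)] /\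
  [/\ rnorm (x' - x) <= d * rnorm (T x), rnorm (T x') = rnorm v &
    rnorm (T x') ^+ 2 <= ip (T x') (T x)].
Proof.
move=> Dx d0.
have [|r y z Dy Dz|||w [w' [u [K [hu hf]]]]] :=
  @graph_riesz R H dot dot_norm (dom T) (fun y => d%:C *: T y) (fun y =>
    ip y x) (rnorm x ^+ 2).
- exact: (op_dom0 linT).
- rewrite (opZD linT) // !ipE; split => //; first exact: (op_domZD linT).
  by rewrite scalerDr !scalerA mulrC.
- exact: sqr_ge0.
- move=> y Dy; rewrite mulrDr ler_wpDr ?(mulr_ge0
  (sqr_ge0 _)) ?sqr_ge0 // -exprMn.
  rewrite -real_normK ?num_real // lerXn2r ?nnegrE ?mulr_ge0 ?rnorm_ge0 //
    mulrC.
  exact: ip_abs.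
have K0 : 0 <= K.
  by have [_ + _] := hu 0%N; rewrite expr0 mulr1; apply: le_trans;
    exact: rnorm_ge0.
have half_ge0 : 0 <= 2^-1 :> R by rewrite invr_ge0.
have [Dw Tw] : dom T w /\ (d^-1)%:C *: w' = T w.
  apply: (closed_operator_limit (u := u) (C := K * (1 + d^-1)) clT
    (half_itv R)) => n.
  have [Dun h1 h2] := hu n; split=> //.
    apply: le_trans h1 _; rewrite ler_wpM2r ?exprn_ge0 ?half_ge0 // ler_peMr //.
    by rewrite lerDl invr_ge0 ltW.
  have -> : T (u n) - (d^-1)%:C *: w' = (d^-1)%:C *: (d%:C *: T (u n) - w').
    by rewrite scalerBr scalerA -rmorphM mulVf ?gt_eqF // scale1r.
  rewrite rnormZR gtr0_norm ?invr_gt0 //.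
  apply: le_trans (ler_wpM2l _ h2) _; first by rewrite invr_ge0 ltW.
  by rewrite mulrA ler_wpM2r ?exprn_ge0 ?half_ge0 // mulrDr mulr1 mulrC lerDr.
have w'E : w' = d%:C *: T w.
  by rewrite -Tw scalerA -rmorphM mulfV ?gt_eqF // scale1r.
have {hf} hf y : dom T y -> ip y x = ip y w + d ^+ 2 * ip (T y) (T w).
  by move=> Dy; rewrite hf // w'E !ipE; ring.
have adjTw : adjoint_at dot T (T w) ((d ^- 2)%:C *: (x - w)).
  apply: (adjoint_at_ip linT) => y Dy; rewrite !ipE hf //.
  by field; rewrite gt_eqF.
have [domE appE] := commT.
have Ew : dom (op_comp T (adjoint dot T)) w.
  by rewrite domE; split=> //=; exists ((d ^- 2)%:C *: (x - w)).
have [adw Dv] := Ew.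
exists w, (adjoint dot T w).
have adj z : dom (adjoint dot T) z -> adjoint_at dot T z (adjoint dot T z).
  by case=> v hv; exact: (xgetPex 0 (ex_intro _ v hv)).
have Tv : T (adjoint dot T w) = adjoint dot T (T w).
  by have := appE w (mem_set Ew).
have aTw : adjoint_at dot T (T w) (T (adjoint dot T w)).
  by rewrite Tv; apply: adj; exists ((d ^- 2)%:C *: (x - w)).
have aw := adj w adw.
have i1 := hf _ (op_domB linT Dw Dx).
rewrite (opB linT) // in i1.
(* The equation for [w], tested against [w - x]. *)
have i2 : rnorm (w - x) ^+ 2 = d ^+ 2 * (ip (T w) (T x) - rnorm (T w) ^+ 2).
  rewrite -!(ipxx dot_norm); move: i1;
    rewrite !ipE (ipC dot (T x)) (ipC dot x w); lra.
have i3 : rnorm (T w) ^+ 2 <= ip (T w) (T x).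
  by rewrite -subr_ge0 -(pmulr_rge0 _ (exprn_gt0 2 d0)) -i2 sqr_ge0.
split; split=> //.
  have := ip_le dot_norm (T w) (T x) => i4.
  have n1 := rnorm_ge0 (T w); have n2 := rnorm_ge0 (T x);
    have n3 := rnorm_ge0 (w - x).
  have i5 : rnorm (T w) <= rnorm (T x) by rewrite leNgt; apply/negP => ?; nra.
  rewrite -(ler_pXn2r (n := 2)) ?nnegrE ?mulr_ge0 ?rnorm_ge0 ?(ltW d0) // i2
    exprMn.
  rewrite ler_pM2l ?exprn_gt0 //; nra.
apply/eqP; rewrite -(eqrXn2 (n := 2)) ?rnorm_ge0 // -!(ipxx dot_norm);
  apply/eqP.
by rewrite (adjoint_atE aTw Dw) ipC (adjoint_atE aw Dv).
Qed.

(** Holds for the approximations [x'] of [x] because their adjoint images have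
    the norm of [T x'], and passes to the limit. *)
Lemma normal_ip_bound x y : dom T x -> dom T y ->
  `|ip (T y) x| <= rnorm (T x) * rnorm y.
Proof.
move=> Dx Dy.
rewrite -subr_le0; apply: (le0_geometric (C := rnorm (T y) * rnorm (T x))
  (half_itv R)) => n.
have hn : 0 < 2^-1 ^+ n :> R by rewrite exprn_gt0 // invr_gt0.
have [x' [v [[_ _ ax' _] [hx' Tx' i3]]]] := normal_approximation Dx hn.
have i4 := ip_le dot_norm (T x') (T x).
have n1 := rnorm_ge0 (T x'); have n2 := rnorm_ge0 (T x).
have i5 : rnorm (T x') <= rnorm (T x) by rewrite leNgt; apply/negP => ?; nra.
have -> : ip (T y) x = ip y v - ip (T y) (x' - x).
  by rewrite -(adjoint_atE ax' Dy) !ipE; ring.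
have j1 := ip_abs dot_norm y v; have j2 := ip_abs dot_norm (T y) (x' - x).
have j3 := ler_wpM2l (rnorm_ge0 (T y)) hx'.
have j4 := ler_wpM2l (rnorm_ge0 y) i5.
have := ler_normB (ip y v) (ip (T y) (x' - x)).
rewrite -Tx' in j1; lra.
Qed.

Lemma normal_adjoint_exists x : dom T x -> exists w, adjoint_at dot T x w.
Proof.
move=> Dx; apply: (adjoint_at_exists dot_norm linT denseT (rnorm_ge0
  (T x))) => y Dy.
exact: normal_ip_bound.
Qed.

(** One inequality is [normal_ip_bound]. For the other, [T x] is tested on [y]
    in [dom T], where [ip (T x) y] is the limit of [ip (T x') y] and [|T x'| <=
    |w|]: indeed [|T x'|^2 <= ip (T x') (T x) = ip v w] with [|v| = |T x'|]. *)
Lemma normal_adjoint_norm x w : dom T x -> adjoint_at dot T x w ->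
  rnorm w = rnorm (T x).
Proof.
move=> Dx ax; apply/eqP; rewrite eq_le; apply/andP; split.
  apply: (dense_ip_bound dot_norm denseT (rnorm_ge0 _)) => y Dy.
  by rewrite -(adjoint_atE ax Dy) normal_ip_bound.
apply: (dense_ip_bound dot_norm denseT (rnorm_ge0 _)) => y Dy.
have [z az] := normal_adjoint_exists Dy.
rewrite -subr_le0; apply: (le0_geometric (C := rnorm z * rnorm (T x))
  (half_itv R)) => n.
have hn : 0 < 2^-1 ^+ n :> R by rewrite exprn_gt0 // invr_gt0.
have [x' [v [[Dx' Dv ax' aTx'] [hx' Tx' i3]]]] := normal_approximation Dx hn.
have n1 := rnorm_ge0 (T x'); have n2 := rnorm_ge0 w.
have i4 : rnorm (T x') <= rnorm w.
  have := ip_le dot_norm v w.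
  move: i3; rewrite ipC (adjoint_atE aTx' Dx) ipC (adjoint_atE ax Dv) -Tx' =>
    i3 i4.
  by rewrite leNgt; apply/negP => ?; nra.
have -> : ip y (T x) = ip (T x') y - ip (x' - x) z.
  by rewrite ipC (adjoint_atE az Dx) (adjoint_atE az Dx') !ipE; ring.
have j1 := ip_abs dot_norm (T x') y; have j2 := ip_abs dot_norm (x' - x) z.
have j3 := ler_wpM2l (rnorm_ge0 z) hx'.
have j4 := ler_wpM2r (rnorm_ge0 y) i4.
have := ler_normB (ip (T x') y) (ip (x' - x) z); lra.
Qed.

(** * The resolvent and the numerical range of a normal operator *)
Lemma normal_shift_norm z x w : dom T x -> adjoint_at dot T x w ->
  rnorm (w - z^*%C *: x) = rnorm (op_shift T z x).
Proof.
move=> Dx ax; apply/eqP; rewrite -(eqrXn2 (n := 2)) ?rnorm_ge0 //; apply/eqP.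
rewrite /op_shift !(rnormB_sqr dot_norm) (normal_adjoint_norm Dx ax).
have -> : ip w (z^*%C *: x) = ip (T x) (z *: x).
  by rewrite /re_dot !dotZr (ax x Dx) (dotC dot w x);
    case: z (dot x w) => [p q] [r s] /=; ring.
by rewrite !rnormZ /rnorm normcJ.
Qed.

(** Inner-product form of the normality of [T - z]; with [x] in the range of
    the resolvent it gives the log-convexity of its orbits. *)
Lemma normal_shift_ip z x y : dom T x -> dom T y ->
  ip (op_shift T z y) x <= rnorm (op_shift T z x) * rnorm y.
Proof.
move=> Dx Dy.
have [w ax] := normal_adjoint_exists Dx.
rewrite -(normal_shift_norm z Dx ax) mulrC.
have -> : ip (op_shift T z y) x = ip y (w - z^*%C *: x).
  rewrite /op_shift !ipE (adjoint_atE ax Dy); congr (_ - _).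
  by rewrite /re_dot dotZl dotZr; case: z (dot y x) => [p q] [r s] /=; ring.
exact: ip_le.
Qed.

(** Since [w] is almost an eigenvalue with defect [k], the resolvent [G] at [w]
    has norm [nu >= 1 / k]. An approximate eigenvalue [nu / l] of [G] of
    maximal modulus corresponds to [w + l / nu] for [T]. *)
Lemma approx_eigen_step w k eta : resolvent_set T w -> approx_eigen T w k ->
  0 < eta -> exists w', rnorm (w' - w) <= k /\ approx_eigen T w' eta.
Proof.
move=> rw [u [Du u0 hu]] eta0.
have [G [M [M0 DG GK KG hM]]] := resolventP rw.
have linG := resolvent_linear linT DG GK KG.
have G0 : G 0 = 0.
  have := linG 1 0 0; rewrite !scale1r addr0 => /(congr1 (+%R^~ (- G 0))).
  by rewrite subrr addrK.
have GZ c y : G (c *: y) = c *: G y.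
  by rewrite -[c *: y]addr0 linG G0 addr0.
set y0 := op_shift T w u in hu.
have Gy0 : G y0 = u by exact: KG.
have y00 : 0 < rnorm y0.
  rewrite rnorm_gt0; apply/eqP => y0E; move: Gy0 u0.
  by rewrite y0E G0 => <-; rewrite rnorm0 ltxx.
have k0 : 0 < k by rewrite -(pmulr_lgt0 _ u0) (lt_le_trans y00).
pose E := [set r | exists y, rnorm y = 1 /\ r = rnorm (G y)].
have unit y : 0 < rnorm y -> rnorm ((rnorm y)^-1%:C *: y) = 1.
  by move=> y1; rewrite rnormZR gtr0_norm ?invr_gt0 // mulVf ?gt_eqF.
have hE : has_sup E.
  split; first by exists (rnorm (G ((rnorm y0)^-1%:C *: y0))),
    ((rnorm y0)^-1%:C *: y0); rewrite unit.
  by exists M => _ [y [y1 ->]]; have := hM y; rewrite y1 mulr1.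
set nu := sup E.
have nu_ub y : rnorm (G y) <= nu * rnorm y.
  have [->|] := eqVneq y 0; first by rewrite G0 rnorm0 mulr0.
  rewrite -rnorm_gt0 => y1; rewrite -ler_pdivrMr // mulrC.
  have : E (rnorm (G ((rnorm y)^-1%:C *: y)))
    by exists ((rnorm y)^-1%:C *: y); rewrite unit.
  move/(sup_upper_bound hE); rewrite GZ rnormZR gtr0_norm ?invr_gt0 //.
have nuk : 1 <= nu * k.
  have := nu_ub y0; rewrite Gy0 => h.
  rewrite leNgt; apply/negP => hlt.
  have nu0 : 0 <= nu by rewrite -(pmulr_lge0 _ y00) (le_trans _ h) // rnorm_ge0.
  have := ler_wpM2l nu0 hu; nra.
have nu0 : 0 < nu by rewrite -(pmulr_lgt0 _ k0) (lt_le_trans ltr01).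
pose N y := nu^-1%:C *: G y.
have rN y : rnorm (N y) = nu^-1 * rnorm (G y).
  by rewrite rnormZR gtr0_norm ?invr_gt0.
have linN c x y : N (c *: x + y) = c *: N x + N y.
  by rewrite /N linG scalerDr !scalerA mulrC.
have contrN y : rnorm (N y) <= rnorm y by rewrite rN mulrC ler_pdivrMr // mulrC.
have convN y : rnorm (N y) ^+ 2 <= rnorm (N (N y)) * rnorm y.
  rewrite !rN /N GZ rnormZR gtr0_norm ?invr_gt0 // exprMn.
  have -> (a b c : R) : a * (a * b) * c = a ^+ 2 * (b * c) by ring.
  rewrite ler_pM2l ?exprn_gt0 ?invr_gt0 // -(ipxx dot_norm) mulrC.
  by have := normal_shift_ip w (DG y) (DG (G y)); rewrite !GK.
have normN e : 0 < e -> exists x, rnorm x = 1 /\ 1 - e <= rnorm (N x).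
  move=> e0; have [_ [y [y1 ->]] hy] := sup_adherent (mulr_gt0 nu0 e0) hE.
  exists y; split=> //; rewrite rN -(ler_pM2l nu0) mulrA mulfV ?gt_eqF // mul1r.
  by rewrite mulrBr mulr1 ltW.
(* The cap [1 / 2] ensures [|y| <= 2 |N y|], so that [G y] is not small. *)
pose eta' := Num.min (2^-1) (eta * nu / 2).
have eta'0 : 0 < eta' by rewrite lt_min invr_gt0 ltr0n /= !mulr_gt0 // invr_gt0.
have [l [y [l1 y1 hy]]] := approximate_eigenvalue dot_norm linN contrN convN
  normN eta'0.
have e1 : eta' <= 2^-1 by rewrite ge_min lexx.
have e2 : eta' <= eta * nu / 2 by rewrite ge_min lexx orbT.
exists (w + l * nu^-1%:C); rewrite addrC addKr.
split.
  rewrite rnormM l1 mul1r rnormC gtr0_norm ?invr_gt0 //.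
  by rewrite -(ler_pM2l nu0) mulfV ?gt_eqF.
have h2 : rnorm y <= 2 * (nu^-1 * rnorm (G y)).
  have := rnorm_triangle (l *: N y) y 0;
    rewrite !subr0 rnormZ l1 mul1r rN => h; nra.
exists (G y); split=> //.
  have : 0 < nu^-1 * rnorm (G y) by lra.
  by rewrite pmulr_rgt0 // invr_gt0.
rewrite (op_shift_shift _ _ w) GK [w + _]addrC addrK -scalerA.
apply: le_trans hy _.
apply: le_trans (ler_wpM2l (ltW eta'0) h2) _.
apply: le_trans (ler_wpM2r _ e2) _.
  by rewrite !mulr_ge0 ?rnorm_ge0 // invr_ge0 ltW.
rewrite [leLHS](_ : _ = eta * rnorm (G y)) //.
by field; rewrite gt_eqF.
Qed.

(** If the estimate fails at [x], then [z] is an approximate eigenvalue with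
    defect [k < d]. One step leads to a point at distance at most [k] with a
    defect as small as desired, and the following steps, with geometrically
    decreasing defects, stay within distance [d] of [z] and converge to a
    resolvent point. Completeness of the scalars is read off from that of [H],
    through the sequence [W n *: x]. *)
Lemma normal_shift_lower z (d : R) :
  (forall w, rnorm (w - z) < d -> resolvent_set T w) ->
  forall x, dom T x -> d * rnorm x <= rnorm (op_shift T z x).
Proof.
move=> ball_res x Dx; rewrite leNgt; apply/negP => hlt.
have x0 : 0 < rnorm x.
  rewrite lt_def rnorm_ge0 andbT; apply/eqP => x0; move: hlt.
  by rewrite x0 mulr0 ltNge rnorm_ge0.
pose k := rnorm (op_shift T z x) / rnorm x.
have k0 : 0 <= k by rewrite divr_ge0 ?rnorm_ge0.
have kd : k < d by rewrite ltr_pdivrMr.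
have ax : approx_eigen T z k by exists x; rewrite /k divfK ?gt_eqF.
pose h : R := 2^-1; have h01 := half_itv R.
(* The first step costs at most [k], the others at most [2 * C] in total. *)
pose C := (d - k) / 4; have C0 : 0 < C by rewrite /C; lra.
have [|w1 [hw1 aw1]] := approx_eigen_step _ ax C0.
  by apply: ball_res; rewrite subrr rnorm0 (le_lt_trans k0).
have hn0 n : 0 < h ^+ n by rewrite exprn_gt0 // invr_gt0.
have C2 : k + 2 * C < d by rewrite /C; lra.
pose inv n w := rnorm (w - z) <= k + 2 * C * (1 - h ^+ n) /\ approx_eigen T w
  (C * h ^+ n).
have /choice[F hF] (p : nat * R[i]) : exists w', inv p.1 p.2 ->
    inv p.1.+1 w' /\ rnorm (w' - p.2) <= C * h ^+ p.1.
  case: p => n w /=; have [[iw aw]|] := pselect (inv n w); last by exists 0.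
  have [|w' [hw' aw']] := approx_eigen_step _ aw (mulr_gt0 C0 (hn0 n.+1)).
    apply: ball_res; apply: le_lt_trans iw _; apply: le_lt_trans C2.
    have := hn0 n; nra.
  exists w' => _; split=> //; split=> //.
  apply: le_trans (rnorm_triangle w _ _) _; apply: le_trans (lerD hw' iw) _.
  by rewrite exprS /h; lra.
pose W := fix W n := if n is m.+1 then F (m, W m) else w1.
have invW n : inv n (W n).
  elim: n => [|n IH]; last by have [] := hF (n, W n) IH.
  by rewrite /inv expr0 subrr mulr0 addr0 mulr1.
have stepW n : rnorm (W n.+1 - W n) <= C * h ^+ n
  by have [] := hF (n, W n) (invW n).
have [|v hv] := geometric_limit (u := fun n => W n *: x) (C := C * rnorm x) h01.
  by move=> n; rewrite -scalerBl rnormZ mulrAC ler_wpM2r ?rnorm_ge0.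
(* The limit of [W n *: x] is [w *: x]; its coordinate along [x] is [w]. *)
pose w := dot v x / dot x x.
have dxx : dot x x = (rnorm x ^+ 2)%:C by rewrite dot_norm normE rmorphXn.
have dxx0 : dot x x != 0.
  by rewrite dxx -(rmorph0 (real_complex R)) (inj_eq
    (@complexI R)) gt_eqF ?exprn_gt0.
have hw n : rnorm (W n - w) <= 2 * C * h ^+ n.
  have -> : W n - w = dot (W n *: x - v) x / dot x x.
    by rewrite -[- v]scaleN1r dotDl !dotZl mulN1r mulrBl mulfK.
  rewrite rnormM rnormV dxx rnormC ger0_norm ?sqr_ge0 // ler_pdivrMr
    ?exprn_gt0 //.
  apply: le_trans (rnorm_dot dot_norm _ _) _.
  apply: le_trans (ler_wpM2r (rnorm_ge0 x) (hv n)) _.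
  by rewrite /h le_eqVlt; apply/orP; left; apply/eqP; field.
apply: (resolvent_not_limit (w := w) (W := W) (C := 2 * C) _ h01) => //.
  apply: ball_res; apply: le_lt_trans C2.
  apply: le_trans (rnorm_triangle w1 _ _) _; rewrite addrC lerD //.
  by rewrite rnorm_distC; have := hw 0%N; rewrite expr0 mulr1.
move=> n; have [_ [u [Du u0 hu]]] := invW n; exists u; split=> //.
apply: le_trans hu _; rewrite ler_wpM2r ?rnorm_ge0 // ler_wpM2r ?(ltW
  (hn0 n)) //; lra.
Qed.

(** With [z = (s - l) e], the disc of radius [l] around [z] lies in the open
    half-plane beyond the edge, hence in the resolvent set. Expanding [l^2
    |x|^2 <= |(T - z) x|^2] and letting [l] grow leaves the claim. *)
Lemma normal_half_plane (e : R[i]) (s : R) : rnorm e = 1 ->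
  (forall t, spectrum T t -> s <= complex.Re (e^*%C * t)) ->
  forall x, dom T x -> s * rnorm x ^+ 2 <= ip (T x) (e *: x).
Proof.
move=> e1 hs x Dx.
have ee : e^*%C * e = 1 by rewrite mulrC -sqr_normc normE e1 expr1n.
have key (l : R) : 0 < l ->
    0 <= rnorm (T x) ^+ 2 + (s ^+ 2 - 2 * s * l) * rnorm x ^+ 2
       - 2 * (s - l) * ip (T x) (e *: x).
  move=> l0; pose z := (s - l)%:C * e.
  have : l * rnorm x <= rnorm (op_shift T z x).
    apply: normal_shift_lower => // w hw; apply: contrapT => /hs.
    have -> : complex.Re (e^*%C * w) = complex.Re (e^*%C * (w - z)) + (s - l).
      rewrite mulrBr /z mulrCA ee mulr1.
      by case: (e^*%C * w) => p q /=; ring.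
    have := ler_norm (complex.Re (e^*%C * (w - z))).
    have := Re_le_rnorm (e^*%C * (w - z)).
    by rewrite rnormM /rnorm normcJ -/(rnorm e) -/(rnorm (w - z)) e1; lra.
  rewrite -(ler_pXn2r (n := 2)) ?nnegrE ?mulr_ge0 ?rnorm_ge0 ?(ltW l0) //.
  rewrite /op_shift (rnormB_sqr dot_norm) /z -scalerA !ipE rnormZR rnormZ e1
    mul1r.
  rewrite !exprMn real_normK ?num_real //; lra.
rewrite leNgt; apply/negP => hlt.
set g := ip _ _ in key hlt; set n := rnorm x ^+ 2 in key hlt.
pose K := rnorm (T x) ^+ 2 + s ^+ 2 * n - 2 * s * g.
have D0 : 0 < s * n - g by lra.
(* For this value of [l] the right-hand side of [key] would be negative. *)
have l0 : 0 < (`|K| + 1) / (2 * (s * n - g)).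
  by rewrite divr_gt0 ?mulr_gt0 // ltr_wpDl.
have := key _ l0; set l := _ / _.
have : 2 * l * (s * n - g) = `|K| + 1 by rewrite /l; field; rewrite gt_eqF.
have := ler_norm K; rewrite /K; lra.
Qed.

(** * Real and imaginary parts of a normal operator *)
Lemma strip_im_form (g1 g2 : R) :
  spectrum T `<=` [set z | g1 <= complex.Im z <= g2] ->
  forall x, dom T x ->
  `|ip (T x) ('i *: x)| <= Num.max `|g1| `|g2| * rnorm x ^+ 2.
Proof.
move=> hT x Dx.
have h1 : g1 * rnorm x ^+ 2 <= ip (T x) ('i *: x).
  apply: (normal_half_plane (rnormi R)) => // t /hT /= /andP[+ _].
  by case: t => p q /=; lra.
have h2 : - g2 * rnorm x ^+ 2 <= ip (T x) ((- 'i) *: x).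
  apply: normal_half_plane => //; first by rewrite rnormN rnormi.
  move=> t /hT /= /andP[_ +].
  by case: t => p q /=; lra.
rewrite scaleNr ipNr in h2.
have m1 : `|g1| <= Num.max `|g1| `|g2| by rewrite le_max lexx.
have m2 : `|g2| <= Num.max `|g1| `|g2| by rewrite le_max lexx orbT.
have n0 : 0 <= rnorm x ^+ 2 by exact: sqr_ge0.
have a1 := ler_norm (- g1); have a2 := ler_norm g2; rewrite normrN in a1.
rewrite ler_norml; apply/andP; split; nra.
Qed.

(** The form [b] is symmetric and [b x x] is twice [ip (T x) ('i *: x)], so
    polarization bounds [b] by its diagonal; and [T x - w] represents [b x] up
    to multiplication by ['i]. *)
Lemma bounded_skew_part (g : R) : 0 <= g ->
  (forall x, dom T x -> `|ip (T x) ('i *: x)| <= g * rnorm x ^+ 2) ->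
  forall x w, dom T x -> adjoint_at dot T x w -> rnorm
    (T x - w) <= 2 * g * rnorm x.
Proof.
move=> g0 hg x w Dx ax.
pose b x y := ip (T x) ('i *: y) + ip (T y) ('i *: x).
have bquad y z : dom T y -> dom T z -> b y z <= g *
  (rnorm y ^+ 2 + rnorm z ^+ 2).
  move=> Dy Dz.
  have h1 := hg _ (op_domD linT Dy Dz); have h2 := hg _ (op_domB linT Dy Dz).
  move: h1 h2; rewrite opD ?opB // !scalerDr scalerN !ipE !ler_norml.
  rewrite (rnormB_sqr dot_norm) (rnormD_sqr dot_norm) /b =>
    /andP[_ h1] /andP[h2 _].
  lra.
have bbound y z : dom T y -> dom T z -> b y z <= 2 * g * rnorm y * rnorm z.
  move=> Dy Dz.
  have bZ p q : b (p%:C *: y) (q%:C *: z) = p * q * b y z.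
    by rewrite /b !opZ // !scalerA ![_ * _%:C]mulrC -!scalerA !ipE; ring.
  have [->|y0] := eqVneq y 0.
    by rewrite /b (op0 linT) scaler0 !ipE rnorm0; lra.
  have [->|z0] := eqVneq z 0.
    by rewrite /b (op0 linT) scaler0 !ipE rnorm0; lra.
  move: y0 z0; rewrite -!rnorm_gt0 => y0 z0.
  have := bquad _ _ (op_domZ linT (rnorm z)%:C Dy) (op_domZ linT
    (rnorm y)%:C Dz).
  rewrite bZ !rnormZR !gtr0_norm // => h.
  rewrite -(ler_pM2l (mulr_gt0 z0 y0)); lra.
apply: (dense_ip_bound dot_norm denseT); first by rewrite !mulr_ge0 ?rnorm_ge0.
(* Take [- 'i *: y] as second argument of [b]. *)
have key y : dom T y -> ip y (T x - w) <= 2 * g * rnorm x * rnorm y.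
  move=> Dy; have D' := op_domZ linT (- 'i) Dy.
  have := bbound _ _ Dx D'; rewrite rnormZ rnormN rnormi mul1r; apply: le_trans.
  rewrite /b scalerA mulrN -expr2 sqr_i opprK scale1r.
  by rewrite (opZ linT) // scaleNr ipNl ipii (adjoint_atE ax Dy) !ipE
    (ipC dot y).
move=> y Dy; rewrite ler_norml key // andbT lerNl -ipNl.
have := key (- y); rewrite rnormN; apply.
by rewrite -scaleN1r; exact: op_domZ.
Qed.

(** The sign [sg] treats both half-planes at once. Write [S] for half the sum
    of [T] and its adjoint, and [N], [P], [n] for [|S x|^2], [ip (S x) x],
    [|x|^2]. Then [V = |(S - s) x|^2] and [sg * (P - s * n)] are nonnegative,
    and the two sides of the claim are dominated by, respectively dominate,
    combinations of [V], [sg * (P - s * n)] and [n] that are compared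
    coefficientwise. *)
Lemma normal_relative_bound (A : operator H) (a b g sg s : R) (z : R[i]) :
  sg ^+ 2 = 1 -> b ^+ 2 < 1 -> 0 <= g ->
  (forall x, dom T x -> `|ip (T x) ('i *: x)| <= g * rnorm x ^+ 2) ->
  (forall x, dom T x -> sg * s * rnorm x ^+ 2 <= sg * ip (T x) x) ->
  (forall x, dom T x ->
     rnorm (A x) ^+ 2 <= a ^+ 2 * rnorm x ^+ 2 + b ^+ 2 * rnorm (T x) ^+ 2) ->
  0 < sg * (s - complex.Re z) ->
  a ^+ 2 + b ^+ 2 * g ^+ 2 + b ^+ 2 * s ^+ 2 < (s - complex.Re z) ^+ 2 ->
  exists q, 0 <= q < 1 /\
    forall x, dom T x -> rnorm (A x) <= q * rnorm (op_shift T z x).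
Proof.
set r := complex.Re z => sg2 b1 g0 him hre hA hd hlt.
set D := sg * (s - r) in hd.
have D2 : D ^+ 2 = (s - r) ^+ 2 by rewrite exprMn sg2 mul1r.
have D20 : 0 < D ^+ 2 by exact: exprn_gt0.
set c := a ^+ 2 + b ^+ 2 * g ^+ 2 + b ^+ 2 * s ^+ 2 in hlt.
pose q2 := Num.max (b ^+ 2) (c / D ^+ 2).
have q2b : b ^+ 2 <= q2 by rewrite le_max lexx.
have q2c : c <= q2 * D ^+ 2 by rewrite -ler_pdivrMr // le_max lexx orbT.
have q20 : 0 <= q2 by rewrite (le_trans _ q2b) // sqr_ge0.
have q21 : q2 < 1 by rewrite gt_max b1 /= ltr_pdivrMr // mul1r D2.
have q2s : b ^+ 2 * (sg * s) <= q2 * D.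
  have h0 : 0 <= q2 * D by rewrite mulr_ge0 // ltW.
  have h1 : b ^+ 2 * s ^+ 2 <= c
    by rewrite /c lerDr (addr_ge0 (sqr_ge0 _)) ?(mulr_ge0 (sqr_ge0 _)) ?sqr_ge0.
  have h2 : (b ^+ 2 * (sg * s)) ^+ 2 <= (q2 * D) ^+ 2.
    have -> : (b ^+ 2 * (sg * s)) ^+ 2 = b ^+ 2 * (b ^+ 2 * s ^+ 2).
      by rewrite -[RHS]mul1r -sg2; ring.
    have -> : (q2 * D) ^+ 2 = q2 * (q2 * D ^+ 2) by ring.
    apply: ler_pM; [exact: sqr_ge0|by rewrite mulr_ge0 ?sqr_ge0|exact: q2b|].
    exact: le_trans h1 q2c.
  rewrite leNgt; apply/negP => h3; nra.
exists (Num.sqrt q2); split.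
  by rewrite sqrtr_ge0 -[ltRHS]sqrtr1 ltr_sqrt.
move=> x Dx.
rewrite -(ler_pXn2r (n := 2)) ?nnegrE ?mulr_ge0 ?rnorm_ge0 ?sqrtr_ge0 //.
rewrite exprMn sqr_sqrtr //; apply: le_trans (hA x Dx) _.
have [w ax] := normal_adjoint_exists Dx.
have wT := normal_adjoint_norm Dx ax.
have skew := bounded_skew_part g0 him Dx ax.
set t := T x in wT skew *; set n := rnorm x ^+ 2; set P := ip t x.
have wx : ip w x = P by rewrite ipC -(adjoint_atE ax Dx).
pose N := rnorm (t + w) ^+ 2 / 4.
(* Parallelogram law for [T x] and its adjoint image, of equal norms. *)
have F1 : rnorm t ^+ 2 <= N + g ^+ 2 * n.
  have := parallelogram dot_norm t w; rewrite wT.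
  have : rnorm (t - w) ^+ 2 <= (2 * g * rnorm x) ^+ 2.
    by rewrite lerXn2r ?nnegrE ?mulr_ge0 ?rnorm_ge0.
  rewrite /N /n; lra.
(* Twice the real part of [T - z] is the sum of [T - z] and its adjoint, whose
   values at [x] have the same norm. *)
have F2 : N - 2 * r * P + r ^+ 2 * n <= rnorm (op_shift T z x) ^+ 2.
  have sw := normal_shift_norm z Dx ax.
  have := rnormD (op_shift T z x) (w - z^*%C *: x); rewrite sw.
  have -> : op_shift T z x + (w - z^*%C *: x) = t + w - (2 * r)%:C *: x.
    rewrite /op_shift addrACA -opprD -scalerDl addcJ; congr (_ - _ *: _).
    by rewrite rmorphM /= rmorph_nat.
  move=> h; have := rnormB_sqr dot_norm (t + w) ((2 * r)%:C *: x).
  rewrite !ipE wx -/P rnormZR exprMn real_normK ?num_real // -/n.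
  have h0 := rnorm_ge0 (t + w - (2 * r)%:C *: x).
  have := rnorm_ge0 (op_shift T z x); rewrite /N; nra.
have F3 : 0 <= N - 2 * s * P + s ^+ 2 * n.
  have := rnormB_sqr dot_norm (t + w) ((2 * s)%:C *: x).
  rewrite !ipE wx -/P rnormZR exprMn real_normK ?num_real // -/n.
  have := sqr_ge0 (rnorm (t + w - (2 * s)%:C *: x)); rewrite /N; lra.
have n0 : 0 <= n by exact: sqr_ge0.
have G0 : 0 <= sg * (P - s * n) by have := hre x Dx; rewrite -/t -/P -/n; lra.
have b0 := sqr_ge0 b.
apply: le_trans (ler_wpM2l q20 F2).
apply: le_trans (lerD (lexx _) (ler_wpM2l b0 F1)) _.
set V := N - 2 * s * P + s ^+ 2 * n in F3.
have k1 := ler_wpM2r F3 q2b.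
have k2 := ler_wpM2r n0 q2c; rewrite D2 in k2.
have k3 := ler_wpM2r G0 q2s.
have k3a : b ^+ 2 * (sg * s) * (sg * (P - s * n)) = b ^+ 2 * s * (P - s * n).
  by rewrite -[RHS]mul1r -sg2; ring.
have k3b : q2 * D * (sg * (P - s * n)) = q2 * (s - r) * (P - s * n).
  by rewrite -[RHS]mul1r -sg2 /D; ring.
rewrite k3a k3b in k3; rewrite /V /c in k1 k2; lra.
Qed.
End NormalOperators.

(** * Relatively small perturbations *)
Section Perturbation.
Variables (R : realType) (H : completeNormedModType R[i]).

(** The iteration [u |-> y - B u] is a contraction of ratio [q]. *)
Lemma neumann_solve (B : H -> H) (q : R) (y : H) : 0 <= q < 1 ->
  (forall x x', B (x - x') = B x - B x') ->
  (forall x, rnorm (B x) <= q * rnorm x) -> exists p, p + B p = y.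
Proof.
move=> q01 BB hB; have /andP[q0 q1] := q01.
pose u := fix u n := if n is m.+1 then y - B (u m) else 0.
have stepu n : rnorm (u n.+1 - u n) <= rnorm y * q ^+ n.
  elim: n => [|n IH].
    by have := BB 0 0; rewrite /= !subrr => ->; rewrite !subr0 expr0 mulr1.
  have -> : u n.+2 - u n.+1 = - B (u n.+1 - u n).
    by rewrite BB /= opprB [y - _]addrC opprD addrACA subrr addr0 opprK addrC.
  rewrite rnormN exprS mulrCA; apply: le_trans (hB _) _.
  exact: ler_wpM2l.
have [p hp] := geometric_limit q01 stepu.
set K := _ / _ in hp.
exists p; apply/eqP; rewrite -subr_eq0 -rnorm_eq0 eq_le rnorm_ge0 andbT.
apply: (le0_geometric (C := K + K) q01) => n.
have -> : p + B p - y = - (u n.+1 - p) - B (u n - p).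
  by rewrite BB /= !opprB addrACA [_ - _ - _]addrAC subrr add0r.
apply: le_trans (rnormD _ _) _; rewrite !rnormN mulrDl lerD //.
  apply: le_trans (hp _) _.
  have K0 : 0 <= K by have := hp 0%N; rewrite expr0 mulr1; apply: le_trans;
    exact: rnorm_ge0.
  by rewrite ler_wpM2l // exprS ler_piMl ?exprn_ge0 // ltW.
apply: le_trans (hB _) _; apply: le_trans (hp n).
by rewrite ler_piMl ?rnorm_ge0 // ltW.
Qed.

(** With [G] the resolvent of [T], solving [p + A (G p) = y] gives the preimage
    [G p] of [y]; injectivity and the bound on the inverse come from [(1 - q)
    |(T - z) x| <= |(T + A - z) x|]. *)
Lemma resolvent_op_add (T A : operator H) (z : R[i]) (q : R) :
  linear_operator T -> linear_operator A -> dom T `<=` dom A ->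
  resolvent_set T z -> 0 <= q < 1 ->
  (forall x, dom T x -> rnorm (A x) <= q * rnorm (op_shift T z x)) ->
  resolvent_set (op_add T A) z.
Proof.
move=> linT linA DTA rz q01 hA; have /andP[q0 q1] := q01.
have [G [M [M0 DG GK KG hM]]] := resolventP rz.
have linG := resolvent_linear linT DG GK KG.
have GB x y : G (x - y) = G x - G y.
  by rewrite addrC -scaleN1r linG scaleN1r addrC.
have shiftE x : op_shift (op_add T A) z x = op_shift T z x + A x.
  by rewrite /op_shift /= addrAC.
have lower x : dom T x ->
    (1 - q) * rnorm (op_shift T z x) <= rnorm (op_shift (op_add T A) z x).
  move=> Dx; rewrite shiftE.
  have := rnormD (op_shift T z x + A x) (- A x); rewrite addrK rnormN.
  have := hA x Dx; lra.
have q1' : 0 < 1 - q by rewrite subr_gt0.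
have bound x : dom T x -> rnorm x <= M / (1 - q) * rnorm (op_shift
  (op_add T A) z x).
  move=> Dx; have := hM (op_shift T z x); rewrite KG // => h;
    apply: le_trans h _.
  by rewrite -mulrA ler_wpM2l // ler_pdivlMl // lower.
have shiftB x y : dom T x -> dom T y -> op_shift (op_add T A) z (x - y) =
    op_shift (op_add T A) z x - op_shift (op_add T A) z y.
  move=> Dx Dy; rewrite !shiftE (opB linA (DTA _ Dx) (DTA _ Dy)).
  have -> : op_shift T z (x - y) = op_shift T z x - op_shift T z y.
    by rewrite [x - y]addrC -scaleN1r op_shiftZD // scaleN1r addrC.
  by rewrite addrACA -opprD.
have inj : set_inj (dom T) (op_shift (op_add T A) z).
  move=> x y /set_mem Dx /set_mem Dy e; apply/eqP;
    rewrite -subr_eq0 -rnorm_eq0 eq_le rnorm_ge0 andbT.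
  have := bound _ (op_domB linT Dx Dy).
  by rewrite shiftB // e subrr rnorm0 mulr0.
have surj y : exists x, dom T x /\ op_shift (op_add T A) z x = y.
  have [||p <-] := @neumann_solve (A \o G) q y q01.
  - by move=> x x' /=; rewrite GB opB // ; apply: DTA.
  - by move=> x /=; have := hA _ (DG x); rewrite GK.
  by exists (G p); rewrite shiftE GK.
split.
  split=> //.
  by move=> y _; have [x [Dx <-]] := surj y; exists x.
have /choice[F hF] := surj.
exists F.
  by move=> x Dx; apply: inj; rewrite ?inE;
    [exact: (hF _).1|exact: Dx|exact: (hF _).2].
exists (M / (1 - q))%:C => y; have [DF EF] := hF y.
by rewrite !normE -rmorphM lecR -{2}EF bound.
Qed.
End Perturbation.

(** * Half-planes containing the perturbed spectrum *)
Theorem corollary3p5 (R : realType) (H : completeNormedModType R[i])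
    (dot : {dot H for Num.conj}) (dot_norm : forall x : H, dot x x = `|x| ^+ 2)
    (T A : operator H) (a b gamma1 gamma2 : R) :
  normal_operator dot T ->
  linear_operator A ->
  dom T `<=` dom A ->
  0 <= a -> 0 <= b < 1 ->
  (forall x : H, dom T x ->
     `|A x| ^+ 2 <= a%:C ^+ 2 * `|x| ^+ 2 + b%:C ^+ 2 * `|T x| ^+ 2) ->
  gamma1 < gamma2 ->
  spectrum T `<=` [set z | gamma1 <= complex.Im z <= gamma2] ->
  let gamma := Num.max `|gamma1| `|gamma2| in
  (forall betaT : R,
     (forall t, spectrum T t -> betaT <= complex.Re t) ->
     forall z, spectrum (op_add T A) z ->
       betaT - Num.sqrt (a ^+ 2 + b ^+ 2 * gamma ^+ 2 + b ^+ 2 * betaT ^+ 2)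
         <= complex.Re z) /\
  (forall alphaT : R,
     (forall t, spectrum T t -> complex.Re t <= alphaT) ->
     forall z, spectrum (op_add T A) z ->
       complex.Re z <=
         alphaT + Num.sqrt (a ^+ 2 + b ^+ 2 * gamma ^+ 2 + b ^+ 2 * alphaT ^+ 2)).
Proof.
move=> normT linA DTA a0 /andP[b0 b1] hA hg12 hstrip gamma.
have linT : linear_operator T by case: normT.
have g0 : 0 <= gamma by rewrite le_max normr_ge0.
have b21 : b ^+ 2 < 1 by rewrite expr_lt1.
have him := strip_im_form dot_norm normT hstrip.
have hA' x : dom T x ->
    rnorm (A x) ^+ 2 <= a ^+ 2 * rnorm x ^+ 2 + b ^+ 2 * rnorm (T x) ^+ 2.
  by move=> /hA; rewrite !normE -!rmorphXn -!rmorphM -rmorphD lecR.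
have side (sg s : R) : sg ^+ 2 = 1 ->
    (forall t, spectrum T t -> sg * s <= sg * complex.Re t) ->
    forall z, spectrum (op_add T A) z ->
    sg * s - Num.sqrt (a ^+ 2 + b ^+ 2 * gamma ^+ 2 + b ^+ 2 * s ^+ 2) <= sg *
      complex.Re z.
  move=> sg2 hs z hz; rewrite leNgt; apply/negP => hlt.
  set c := a ^+ 2 + _ + _ in hlt.
  have c0 : 0 <= c by rewrite !addr_ge0 ?(mulr_ge0 (sqr_ge0 _)) ?sqr_ge0.
  have sc := sqrtr_ge0 c.
  have rz : resolvent_set T z by apply: contrapT => /hs; lra.
  have sg1 : rnorm (sg%:C : R[i]) = 1.
    by rewrite rnormC; apply/eqP; rewrite -(eqrXn2
      (n := 2)) // real_normK ?num_real // sg2 expr1n.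
  have hre x : dom T x -> sg * s * rnorm x ^+ 2 <= sg * re_dot dot (T x) x.
    move=> Dx; rewrite -ipZr.
    apply: (normal_half_plane dot_norm normT sg1) => // t /hs.
    by case: t => p q /=; lra.
  have d0 : 0 < sg * (s - complex.Re z) by lra.
  have clt : c < (s - complex.Re z) ^+ 2.
    have -> : (s - complex.Re z) ^+ 2 = (sg * (s - complex.Re z)) ^+ 2.
      by rewrite exprMn sg2 mul1r.
    by rewrite -[c](sqr_sqrtr c0) ltrXn2r ?nnegrE ?(ltW d0) //; lra.
  have [q [q01 hq]] := normal_relative_bound dot_norm normT sg2 b21 g0 him hre
    hA' d0 clt.
  exact: hz (resolvent_op_add linT linA DTA rz q01 hq).
split=> [betaT hb z hz|alphaT ha z hz].
  have := side 1 betaT (expr1n _ _) _ z hz.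
  by rewrite !mul1r; apply => t /hb; rewrite !mul1r.
have N1 : (-1) ^+ 2 = 1 :> R by rewrite sqrrN expr1n.
have := side (-1) alphaT N1 _ z hz.
rewrite !mulN1r => h; rewrite -lerN2 opprD; apply: h => t /ha.
by rewrite !mulN1r lerN2.
Qed.
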